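(* Let $p$ be a prime, $n\ge 0$ an integer, and $P$ a nontrivial finite $p$-group of nilpotence class at most $n(p-1)+1$. Let $\mathcal F$ be a saturated fusion system on $P$. Then $\mho^n(Z(P))$ is normal in $\mathcal F$.
   Context: $\mho^n(A)$ denotes the subgroup of the group $A$ generated by all $p^n$-th powers of elements of $A$. A category on $P$ has as objects the subgroups of $P$, with $\mathrm{Hom}_{\mathcal F}(Q,R)$ a set of injective group homomorphisms $Q\to R$ such that every morphism is an $\mathcal F$-isomorphism followed by an inclusion. A saturated fusion system on $P$ is such a category containing all homomorphisms induced by conjugation by elements of $P$, in which $\mathrm{Aut}_P(P)$ is a Sylow $p$-subgroup of $\mathrm{Aut}_{\mathcal F}(P)$, and such that for every $\mathcal F$-isomorphism $\varphi: Q\to Q'$ with $Q'$ fully $\mathcal F$-normalized (i.e. $|N_P(Q')|\ge |N_P(Q'')|$ for all $Q''$ $\mathcal F$-isomorphic to $Q'$), $\varphi$ extends to an $\mathcal F$-morphism $N_\varphi\to P$, where $N_\varphi=\{x\in N_P(Q): \exists y\in N_P(\varphi(Q))\ \forall z\in Q,\ \varphi(xzx^{-1})=y\varphi(z)y^{-1}\}$. For $W\le P$, $N_{\mathcal F}(W)$ is the category on $N_P(W)$ whose morphisms $R_1\to R_2$ are those $\mathcal F$-morphisms $\varphi$ admitting an extension $\tilde\varphi: WR_1\to WR_2$ in $\mathcal F$ with $\tilde\varphi(W)=W$. $W$ is normal in $\mathcal F$ if $\mathcal F = N_{\mathcal F}(W)$. *)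

(* Defs.v *)
From mathcomp Require Import all_boot all_fingroup all_solvable.
Set Implicit Arguments. Unset Strict Implicit. Unset Printing Implicit Defensive.
Local Open Scope group_scope.

(* Encoding of morphisms: an injective homomorphism Q -> R (Q, R subgroups of P)
   is represented by a finite function f : {ffun gT -> gT} that is the identity
   outside Q (so each homomorphism has exactly one representative). *)
Section Fusion.
Variable gT : finGroupType.
Implicit Types (P Q R S W : {set gT}) (f g : {ffun gT -> gT}).

Definition extid Q (h : gT -> gT) : {ffun gT -> gT} :=
  [ffun x => if x \in Q then h x else x].

Definition inj_hom Q R f : bool :=
  [&& [forall x, (x \notin Q) ==> (f x == x)],
      [forall x in Q, forall y in Q, f (x * y) == f x * f y],
      [forall x in Q, forall y in Q, (f x == f y) ==> (x == y)] &
      f @: Q \subset R].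

Definition is_subgroup_of P Q : bool := group_set Q && (Q \subset P).

(* F Q R f  <=>  f is in Hom_F(Q,R) *)
Definition fcat := {set gT} -> {set gT} -> pred {ffun gT -> gT}.

(* conjugation z |-> x z x^-1 on Q  (note z ^ y = y^-1 z y in MathComp) *)
Definition conjmor (x : gT) Q := extid Q (fun z => z ^ x^-1).

Record is_category P (F : fcat) : Prop := {
  cat_hom : forall Q R f, F Q R f ->
     [/\ is_subgroup_of P Q, is_subgroup_of P R & inj_hom Q R f];
  cat_id : forall Q, is_subgroup_of P Q -> F Q Q (extid Q id);
  cat_comp : forall Q R S f g, F Q R f -> F R S g -> F Q S (extid Q (g \o f));
  cat_factor : forall Q R f, F Q R f ->
     F Q (f @: Q) f /\ F (f @: Q) R (extid (f @: Q) id);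
  cat_inv : forall Q R f, F Q R f ->
     exists2 g, F (f @: Q) Q g & {in Q, forall x, g (f x) = x}
}.

Definition AutF P (F : fcat) : {set {ffun gT -> gT}} := [set f | F P P f].
Definition AutP P : {set {ffun gT -> gT}} := [set conjmor x P | x in P].

Definition fisoF (F : fcat) Q R f : bool := F Q R f && (f @: Q == R).

Definition fully_normalized P (F : fcat) Q : Prop :=
  forall R f, fisoF F R Q f -> #|'N_P(R)| <= #|'N_P(Q)|.

Definition Nphi P Q f : {set gT} :=
  [set x in 'N_P(Q) | [exists y in 'N_P(f @: Q),
     [forall z in Q, f (x * z * x^-1) == y * f z * y^-1]]].

Record saturated (p : nat) P (F : fcat) : Prop := {
  sat_cat : is_category P F;
  sat_conj : forall x Q R, x \in P -> is_subgroup_of P Q -> is_subgroup_of P R ->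
     Q :^ x^-1 \subset R -> F Q R (conjmor x Q);
  sat_syl : [/\ AutP P \subset AutF P F, p.-nat #|AutP P|
               & p^'.-nat (#|AutF P F| %/ #|AutP P|)];
  sat_ext : forall Q Q' f, fisoF F Q Q' f -> fully_normalized P F Q' ->
     exists2 g, F (Nphi P Q f) P g & {in Q, g =1 f}
}.

(* W is normal in F, i.e. F = N_F(W) (same objects forces N_P(W) = P) *)
Definition normalF P (F : fcat) W : Prop :=
  [/\ W \subset P, P \subset 'N(W) &
      forall Q R f, F Q R f -> exists g,
        [/\ F (W * Q) (W * R) g, {in Q, g =1 f} & g @: W = W]].

Definition mho (p n : nat) (A : {set gT}) : {set gT} :=
  <<[set x ^+ (p ^ n) | x in A]>>.

End Fusion.

(* Main.v *)
Require Import Defs.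
From HB Require Import structures.
From mathcomp Require Import all_boot all_fingroup all_solvable ssralg.

(* Write W for mho^n(Z(P)). An element x of P that normalises an abelian
   subgroup V and whose p-th power centralises V acts on V as 1 + d
   with (1 + d)^p = 1 and d^(n(p-1)+1) = 0, which forces p^n d = 0, i.e. x centralises
   mho^n(V).

   Any F-morphism should extend to a subgroup containing Z(P) by a morphism
   stabilising W; this goes by downward induction on the order of the domain.
   After composing with automorphisms, only the automorphism group A of a fully
   normalised Q < P with C_P(Q) <= Q remains. Let K be the kernel of the action
   of A on mho^n(Z(Q)), which contains W. If x in N_P(Q) \ Q has x^p in Q, then
   conjugation by x lies in K. The group X of the automorphisms in K induced by
   P is Sylow in K, so A = K N_A(X) by the Frattini argument; K fixes W
   pointwise, and an element of N_A(X) extends to a group containing <Q, x> > Q,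
   where induction applies. *)

Set Implicit Arguments.
Unset Strict Implicit.
Unset Printing Implicit Defensive.
Local Open Scope group_scope.

(** * Unipotent endomorphisms of abelian groups, written additively *)

Section UnipotentAdditive.
Import GRing.Theory.
Local Open Scope ring_scope.
Variables (U : zmodType) (d : {additive U -> U}).

Lemma iter_additiveMn k m u : iter k d (u *+ m) = iter k d u *+ m.
Proof. by elim: k => //= k ->; rewrite raddfMn. Qed.

(** The binomial expansion of (1 + d)^k; the induction step is Pascal's rule. *)
Lemma iter_1Dadditive k v :
  iter k (fun u => u + d u) v = \sum_(i < k.+1) iter i d v *+ 'C(k, i).
Proof.
elim: k => [|k IHk]; first by rewrite big_ord1 /= bin0.
rewrite iterS IHk raddf_sum /= [in RHS]big_ord_recl /= bin0.
under [X in _ = _ + X]eq_bigr => i _ do rewrite /bump /= add1n binS mulrnDr.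
rewrite big_split /= addrA; congr (_ + _); last first.
  by apply: eq_bigr => i _; rewrite raddfMn.
rewrite big_ord_recl /= bin0 [in RHS]big_ord_recr /= bin_small // mulr0n addr0.
by congr (_ + _); apply: eq_bigr => i _; rewrite /bump /= add1n.
Qed.

(* Expanding (1 + d)^p = 1 writes p d as -d^p plus multiples of the p d^j with
   1 < j < p, so a factor p can be traded for d^(p-1). *)
Lemma mulrn_exp_additive_eq0 p n :
    prime p ->
    (forall v, iter p (fun u => u + d u) v = v) ->
    (forall v, iter (n * p.-1).+1 d v = 0) ->
  forall v, d v *+ (p ^ n) = 0.
Proof.
case: p => [|[|q]] // pr_p dp1; rewrite [q.+2.-1]/= => dn0.
have dbig k v : (n * q.+1 < k)%N -> iter k d v = 0.
  by move/subnK <-; rewrite iterD dn0 -(mulr0n 0) iter_additiveMn mulr0n.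
(* Here p = q + 2. [m] counts the available factors p, and [k] bounds the steps left until d^(j+1)
   vanishes by nilpotency. The outer induction absorbs the term in d^p, the inner one the terms
   whose binomial coefficient is divisible by p. *)
suffices trade m k j v : (n * q.+1 < m * q.+1 + j.+1)%N ->
    (n * q.+1 < j.+1 + k)%N -> iter j.+1 d v *+ (q.+2 ^ m) = 0.
  by move=> v; apply: (trade n (n * q.+1)%N 0%N v); rewrite ?addn1 ?add1n.
elim: m k j v => [|m IHm] k j v; first by move/dbig-> => _; rewrite mul0rn.
elim: k j v => [|k IHk] j v jm_big jk_big.
  by rewrite dbig ?mul0rn // -[j.+1]addn0.
have /eqP := dp1 (iter j d v); rewrite iter_1Dadditive big_ord_recl /= bin0 mulr1n.
rewrite -subr_eq0 addrC addKr big_ord_recl /= bin1 addr_eq0 => /eqP du.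
rewrite expnS mulrnA du mulNrn -sumrMnl big1 ?oppr0 // => i _.
rewrite /bump /= !add1n -!iterS -iterD -[(_ + j)%N]/((i.+1 + j).+1)%N.
have [i_lt|q_le_i] := ltnP i q.
  have /dvdnP[b ->]: (q.+2 %| 'C(q.+2, i.+2))%N by apply: prime_dvd_bin.
  rewrite -mulrnA -mulnA -expnS mulnC mulrnA IHk ?mul0rn //.
    by apply: leq_trans jm_big _; rewrite leq_add2l ltnS leq_addl.
  by apply: leq_trans jk_big _; rewrite addnS -addSn leq_add2r ltnS addSn ltnS leq_addl.
rewrite mulrnAC (IHm (n * q.+1)%N) ?mul0rn ?addSn ?ltnS ?leqW ?leq_addl //.
have -> : nat_of_ord i = q by apply/eqP; rewrite eqn_leq q_le_i -ltnS ltn_ord.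
by rewrite -addSn -addnS addnA [(_ + q.+1)%N]addnC -mulSn.
Qed.
End UnipotentAdditive.

(** * Conjugation on an abelian subgroup as 1 + d *)

Section AbelianSubgroupZmodule.
Variables (gT : finGroupType) (V : {group gT}).

(** The proof of commutativity is a parameter of the type, so that the additive structure can be
    attached to this copy of [subg_of V]. *)
Definition abelian_zmod of abelian V := subg_of V.
Variable cVV : abelian V.
HB.instance Definition _ := Finite.copy (abelian_zmod cVV) (subg_of V).

Fact abelian_zmod_addC : @commutative (abelian_zmod cVV) _ *%g.
Proof.
by move=> u v; apply: val_inj; rewrite /= ((centsP cVV) _ (subgP u) _ (subgP v)).
Qed.

HB.instance Definition _ :=
  GRing.isZmodule.Build (abelian_zmod cVV)
    (@mulgA (subg_of V)) abelian_zmod_addC (@mul1g (subg_of V)) (@mulVg (subg_of V)).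

Lemma abelian_zmod_mulrn (u : abelian_zmod cVV) k :
  sgval (GRing.natmul u k) = sgval u ^+ k.
Proof.
elim: k => [|k IHk]; first by rewrite GRing.mulr0n.
by rewrite GRing.mulrS expgS -IHk.
Qed.

End AbelianSubgroupZmodule.

Section CommutatorEndomorphism.
Variables (gT : finGroupType) (V : {group gT}) (cVV : abelian V) (x : gT).
Hypothesis nVx : x \in 'N(V).
Local Notation U := (abelian_zmod cVV).

(** This is d: conjugation by [x] is 1 + d because v ^ x = v * [~ v, x]. *)
Definition commg_endo (u : U) : U := subg V [~ sgval u, x].

Lemma commg_endoE u : sgval (commg_endo u) = [~ sgval u, x].
Proof. by rewrite subgK // commgEl groupM ?groupV ?memJ_norm ?subgP. Qed.

Lemma commg_endo_nmod_morphism : GRing.nmod_morphism commg_endo.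
Proof.
split=> [|u v]; apply: val_inj; first by rewrite /= commg_endoE comm1g.
rewrite /= !commg_endoE commMgJ conjgE -commg_endoE; congr (_ * _).
by rewrite ((centsP cVV) _ (subgP _) _ (subgP v)) mulKg.
Qed.

Lemma commg_endo_1D k (u : U) :
  sgval (iter k (fun u => GRing.add u (commg_endo u)) u) = sgval u ^ (x ^+ k).
Proof.
elim: k => [|k IHk]; first by rewrite conjg1.
rewrite iterS /= commg_endoE; set w := iter k _ u in IHk *.
by rewrite commgEl mulKVg IHk -conjgM -expgSr.
Qed.

(** Each commutator with an element of [P] descends one term of the lower central series, so the
    class of [P] bounds the nilpotency index of d. *)
Lemma commg_endo_lcn (P : {group gT}) k (u : U) :
  V \subset P -> x \in P -> sgval (iter k commg_endo u) \in 'L_k.+1(P).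
Proof.
move=> sVP Px; elim: k => [|k IHk]; first by rewrite lcn1 (subsetP sVP) ?subgP.
by rewrite iterS commg_endoE lcnSn mem_commg.
Qed.

End CommutatorEndomorphism.

Lemma unipotent_cent_Mho (gT : finGroupType) (p n : nat) (P V : {group gT}) x :
    prime p -> p.-group P -> nil_class P <= n * (p - 1) + 1 ->
    V \subset P -> abelian V -> x \in 'N_P(V) -> x ^+ p \in 'C(V) ->
  x \in 'C('Mho^n(V)).
Proof.
move=> pr_p pP clP sVP cVV /setIP[Px nVx] cVxp.
rewrite (MhoEabelian n (pgroupS sVP pP) cVV); apply/centP=> _ /imsetP[v Vv ->].
pose dM := GRing.isNmodMorphism.Build _ _ _ (commg_endo_nmod_morphism cVV nVx).
pose d : {additive abelian_zmod cVV -> abelian_zmod cVV} :=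
  HB.pack (@commg_endo _ _ cVV x) dM.
(* The series starts at ['L_1(P)] = P, so class at most c kills the term of index c + 1. *)
have Lc1: 'L_(n * p.-1).+2(P) = 1.
  by apply/lcn_nil_classP; rewrite ?(pgroup_nil pP) // -subn1 -addn1.
have dp1 (u : abelian_zmod cVV) : iter p (fun u => GRing.add u (d u)) u = u.
  apply: val_inj; rewrite [LHS]commg_endo_1D // /conjg -(centP cVxp) ?mulKg //.
  exact: subgP.
have dn0 (u : abelian_zmod cVV) : iter (n * p.-1).+1 d u = GRing.zero.
  by apply: val_inj; apply/set1gP; rewrite -Lc1; apply: commg_endo_lcn.
have /(congr1 sgval) := mulrn_exp_additive_eq0 pr_p dp1 dn0 (subg V v).
rewrite abelian_zmod_mulrn commg_endoE // subgK //.
(* Since v commutes with [~ v, x], the p^n-th power of [~ v, x] is [~ v^(p^n), x]. *)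
have cvx: commute v [~ v, x].
  by apply: (centsP cVV) => //; rewrite commgEl groupM ?groupV ?memJ_norm.
by rewrite -commXg // => vx1; apply/commute_sym/commgP/eqP.
Qed.

(** * Morphisms of a fusion system, handled as plain functions *)

Section FusionSystem.
Variables (gT : finGroupType) (p : nat) (P : {group gT}) (F : fcat gT).
Hypotheses (pr_p : prime p) (pP : p.-group P) (satF : saturated p P F).
Implicit Types (Q R S N : {group gT}) (f g h : gT -> gT).

Let catF : is_category P F := sat_cat satF.

Lemma group_is_subgroup_of Q : Q \subset P -> is_subgroup_of P Q.
Proof. by move=> sQP; rewrite /is_subgroup_of groupP. Qed.

(** Only the values on [Q] matter here, so composites and inverses need not be truncated by hand. *)
Definition fus (Q R : {set gT}) (f : gT -> gT) : bool := F Q R (extid Q f).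
Definition fiso (Q R : {set gT}) (f : gT -> gT) : bool := fus Q R f && (f @: Q == R).

Lemma extid_in (Q : {set gT}) f : {in Q, extid Q f =1 f}.
Proof. by move=> x Qx; rewrite ffunE Qx. Qed.

Lemma extid_eq (Q : {set gT}) f g : {in Q, f =1 g} -> extid Q f = extid Q g.
Proof. by move=> eq_fg; apply/ffunP=> x; rewrite !ffunE; case: ifP => // /eq_fg. Qed.

Lemma imset_extid (Q : {set gT}) f : extid Q f @: Q = f @: Q.
Proof. by apply: eq_in_imset => x /extid_in->. Qed.

Lemma fus_eq (Q R : {set gT}) f g : {in Q, f =1 g} -> fus Q R f -> fus Q R g.
Proof. by rewrite /fus => /extid_eq->. Qed.

Lemma extid_fcat (Q R : {set gT}) (f : {ffun gT -> gT}) : F Q R f -> extid Q f = f.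
Proof.
move=> Ff; have [_ _ /and4P[/forall_inP f_out _ _ _]] := cat_hom catF Ff.
by apply/ffunP=> x; rewrite ffunE; case: (boolP (x \in Q)) => // /f_out/eqP.
Qed.

Lemma fus_fcat (Q R : {set gT}) (f : {ffun gT -> gT}) : F Q R f -> fus Q R f.
Proof. by move=> Ff; rewrite /fus (extid_fcat Ff). Qed.

Lemma fus_hom (Q R : {set gT}) f : fus Q R f ->
  [/\ is_subgroup_of P Q, is_subgroup_of P R,
      {in Q &, {morph f : x y / x * y}}, {in Q &, injective f} & f @: Q \subset R].
Proof.
move=> Ff; have [sQ sR /and4P[_ /forall_inP fM /forall_inP f_inj sfR]] := cat_hom catF Ff.
have gsQ := andP sQ; split=> // [x y Qx Qy|x y Qx Qy eq_f|].
- have /forall_inP/(_ y Qy)/eqP := fM x Qx.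
  by rewrite !extid_in //; case: gsQ => /group_setP[_ -> //].
- have /forall_inP/(_ y Qy) := f_inj x Qx.
  by rewrite !extid_in // eq_f eqxx => /eqP.
by rewrite -imset_extid.
Qed.

Lemma fus_sub (Q R : {set gT}) f : fus Q R f -> Q \subset P.
Proof. by case/fus_hom=> /andP[]. Qed.

Lemma fus_mem (Q R : {set gT}) f x : fus Q R f -> x \in Q -> f x \in R.
Proof. by case/fus_hom=> _ _ _ _ /subsetP sfR Qx; rewrite sfR ?imset_f. Qed.

Lemma fus_comp (Q R S : {set gT}) f g : fus Q R f -> fus R S g -> fus Q S (g \o f).
Proof.
move=> Ff Fg; have := cat_comp catF Ff Fg; apply: fus_eq => x Qx /=.
by rewrite extid_in // extid_in // (fus_mem Ff).
Qed.

Lemma fus_conj Q R x : x \in P -> Q \subset P -> R \subset P -> Q :^ x \subset R ->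
  fus Q R (fun z => z ^ x).
Proof.
move=> Px sQP sRP sQxR.
(* [conjmor] conjugates by the inverse of its argument, hence [x^-1]. *)
have := sat_conj satF (groupVr Px) (group_is_subgroup_of sQP) (group_is_subgroup_of sRP).
by rewrite /conjmor !invgK; apply.
Qed.

Lemma fus_id Q R : Q \subset R -> R \subset P -> fus Q R id.
Proof.
move=> sQR sRP; apply: (@fus_eq _ _ (fun z => z ^ 1)) => [x _|]; first exact: conjg1.
by rewrite fus_conj ?conjsg1 ?(subset_trans sQR).
Qed.

Lemma fus_img (Q R : {set gT}) f : fus Q R f -> exists S, f @: Q = S /\ fiso Q S f.
Proof.
move=> Ff; have [Ff1 _] := cat_factor catF Ff; rewrite imset_extid in Ff1.
have [_ /andP[gfQ _] _ _ _] := fus_hom Ff1.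
by exists (Group gfQ); rewrite /fiso eqxx andbT.
Qed.

Lemma fus_cod (Q R : {set gT}) S f : fus Q R f -> f @: Q \subset S -> S \subset P -> fus Q S f.
Proof.
move=> /fus_img[T [-> /andP[Ff _]]] sTS sSP.
exact: (fus_comp Ff (fus_id sTS sSP)).
Qed.

Lemma fus_res Q (R S : {set gT}) f : fus R S f -> Q \subset R -> fus Q S f.
Proof.
move=> Ff sQR; have [/andP[gR sRP] _ _ _ _] := fus_hom Ff.
exact: (fus_comp (@fus_id Q (Group gR) sQR sRP) Ff).
Qed.

Lemma fus_fiso (Q R : {set gT}) f : fiso Q R f -> fus Q R f.
Proof. by case/andP. Qed.

Lemma fiso_im (Q R : {set gT}) f : fiso Q R f -> f @: Q = R.
Proof. by case/andP=> _ /eqP. Qed.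

Lemma fiso_card (Q R : {set gT}) f : fiso Q R f -> #|R| = #|Q|.
Proof.
by case/andP=> /fus_hom[_ _ _ f_inj _] /eqP <-; rewrite card_in_imset.
Qed.

Lemma fiso_comp (Q R S : {set gT}) f g : fiso Q R f -> fiso R S g -> fiso Q S (g \o f).
Proof.
move=> /andP[Ff /eqP fQ] /andP[Fg /eqP gR].
by rewrite /fiso (fus_comp Ff Fg) imset_comp fQ gR /=.
Qed.

Lemma fiso_inv (Q R : {set gT}) f : fiso Q R f ->
  exists g, [/\ fiso R Q g, {in Q, cancel f g} & {in R, cancel g f}].
Proof.
case/andP=> Ff /eqP fQ; have [g Fg fK] := cat_inv catF Ff.
rewrite imset_extid fQ in Fg; move/fus_fcat: Fg => Fg; exists g.
have {}fK: {in Q, cancel f g} by move=> x Qx; rewrite -{2}(fK x Qx) extid_in.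
split=> //; last by move=> y; rewrite -fQ => /imsetP[x Qx ->]; rewrite fK.
rewrite /fiso Fg -fQ -imset_comp eqEsubset /=; apply/andP; split; apply/subsetP=> x.
  by case/imsetP=> y Qy -> /=; rewrite fK.
by move=> Qx; apply/imsetP; exists x; rewrite //= fK.
Qed.

Lemma fusJ (Q R : {set gT}) f : fus Q R f -> {in Q &, forall x y, f (x ^ y) = f x ^ f y}.
Proof.
case/fus_hom=> /andP[gQ _] _ fM _ _ x y Qx Qy; pose G := Group gQ.
have fMG: {in G &, {morph f : x y / x * y}} by [].
exact: (morphJ (Morphism fMG)).
Qed.

(** * Fully normalised subgroups and extension of morphisms *)

Definition fnorm (Q : {set gT}) := fully_normalized P F Q.

Lemma fnorm_leq (Q R : {set gT}) f : fnorm R -> fiso Q R f -> #|'N_P(Q)| <= #|'N_P(R)|.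
Proof. by move=> fnR Ff; apply: (fnR _ (extid Q f)); rewrite /fisoF imset_extid. Qed.

(** Choose an F-conjugate of [Q] with the largest normaliser in [P]; its own F-conjugates are again
    F-conjugates of [Q]. *)
Lemma fnorm_exists Q : Q \subset P -> exists R f, fiso Q R f /\ fnorm R.
Proof.
move=> sQP; pose c (R : {set gT}) := [exists f : {ffun gT -> gT}, fisoF F Q R f].
have cQ: c Q.
  apply/existsP; exists (extid Q id); have := fus_id (subxx Q) sQP.
  by rewrite /fisoF imset_extid imset_id eqxx andbT.
have [R /existsP[f /andP[/fus_fcat Ff /eqP fQ]] maxR] :=
  arg_maxnP (fun R : {set gT} => #|'N_P(R)|) cQ.
have [S [fQS Fi]] := fus_img Ff; rewrite fQ in fQS; exists S, f; split=> // T g.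
case/andP=> /fus_fcat Fg /eqP gT'; apply: etrans (maxR T _); first by rewrite fQS.
have /fiso_inv[h [Fh _ _]]: fiso T S g by rewrite /fiso Fg gT' eqxx.
have /andP[Fhf /eqP im_hf] := fiso_comp Fi Fh.
by apply/existsP; exists (extid Q (h \o f)); rewrite /fisoF imset_extid im_hf eqxx andbT.
Qed.

(** The definition conjugates by inverses; replacing z by z ^ y turns it into a statement about the
    right action. *)
Lemma NphiP Q f y :
  reflect (y \in 'N_P(Q) /\ exists2 u, u \in 'N_P(f @: Q) & {in Q, forall z, f (z ^ y) = f z ^ u})
          (y \in Nphi P Q (extid Q f)).
Proof.
have mulJV (x z : gT) : x * z * x^-1 = z ^ x^-1 by rewrite conjgE invgK mulgA.
rewrite /Nphi imset_extid [X in reflect _ X]in_set; apply: (iffP andP) => -[Ny];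
  have nQy: y \in 'N(Q) by [case/setIP: Ny].
  case/exists_inP=> u Nu /forall_inP fu; split=> //; exists u => // z Qz.
  have /eqP := fu (z ^ y) (etrans (memJ_norm _ nQy) Qz).
  by rewrite !mulJV conjgK !extid_in ?memJ_norm // => ->; rewrite conjgKV.
case=> u Nu fu; split=> //; apply/exists_inP; exists u => //; apply/forall_inP=> z Qz.
have Qzy: z ^ y^-1 \in Q by rewrite memJ_norm ?groupV.
by rewrite !mulJV !extid_in // -{2}[z](conjgKV y) fu ?conjgK.
Qed.

Lemma fnorm_ext Q R f : fiso Q R f -> fnorm R -> Q \subset P ->
  exists N g, [/\ N = Nphi P Q (extid Q f) :> {set gT}, fus N P g & {in Q, g =1 f}].
Proof.
move=> Ff fnR sQP; have Ff': fisoF F Q R (extid Q f) by rewrite /fisoF imset_extid.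
have [g /fus_fcat Fg g_f] := sat_ext satF Ff' fnR.
have [/andP[gN _] _ _ _ _] := fus_hom Fg.
by exists (Group gN), g; split=> // z Qz; rewrite g_f ?extid_in.
Qed.

Lemma sub_Nphi Q R f : fiso Q R f -> Q \subset Nphi P Q (extid Q f).
Proof.
move=> Ff; have sQP := fus_sub (fus_fiso Ff); apply/subsetP=> x Qx.
have /andP[gR sRP] : is_subgroup_of P R by case/fus_hom: (fus_fiso Ff).
apply/NphiP; rewrite inE (subsetP sQP) // (subsetP (normG Q)) //; split=> //.
exists (f x) => [|z Qz]; last by rewrite (fusJ (fus_fiso Ff)).
have Rfx := fus_mem (fus_fiso Ff) Qx.
by rewrite (fiso_im Ff) inE (subsetP sRP) // (subsetP (normG R)).
Qed.

(** Conjugation by such an element is trivial on [Q], so 1 serves as its counterpart on the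
    image. *)
Lemma cent_sub_Nphi Q R f : fiso Q R f -> 'C_P(Q) \subset Nphi P Q (extid Q f).
Proof.
move=> Ff; apply/subsetP=> x /setIP[Px cQx]; apply/NphiP.
rewrite inE Px (subsetP (cent_sub Q)) //; split=> //.
exists 1 => [|z Qz]; first exact: group1.
by rewrite conjg1 /conjg -(centP cQx) ?mulKg.
Qed.

(** * Automorphism groups of subgroups and their Sylow subgroups *)

(* The generated group is the set itself when Q \subset P, see mem_autF. *)
Definition autF Q := <<[set a in Aut Q | fus Q Q a]>>%G.
Definition autP Q := (conj_aut Q @* 'N_P(Q))%G.

Lemma mem_autF Q a : Q \subset P -> (a \in autF Q) = (a \in Aut Q) && fus Q Q a.
Proof.
move=> sQP; suffices gA: group_set [set a in Aut Q | fus Q Q a].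
  by rewrite /autF /= gen_set_id // [LHS]in_set.
apply/group_setP; split=> [|b c].
  rewrite in_set group1 /=; apply: fus_eq (fus_id (subxx Q) sQP) => x _.
  by rewrite perm1.
rewrite ![_ \in [set _ in _ | _]]in_set => /andP[Ab Fb] /andP[Ac Fc]; rewrite groupM //=.
by apply: fus_eq (fus_comp Fb Fc) => x _; rewrite permM.
Qed.

Lemma autF_Aut Q a : Q \subset P -> a \in autF Q -> a \in Aut Q.
Proof. by move=> sQP; rewrite mem_autF // => /andP[]. Qed.

Lemma autF_fus Q a : Q \subset P -> a \in autF Q -> fus Q Q a.
Proof. by move=> sQP; rewrite mem_autF // => /andP[]. Qed.

Lemma autF_im Q a : Q \subset P -> a \in autF Q -> a @: Q = Q.
Proof.
by move=> sQP /(autF_Aut sQP) Aa; rewrite -{2}(im_autm Aa) morphimEdom.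
Qed.

Lemma autF_fiso Q a : Q \subset P -> a \in autF Q -> fiso Q Q a.
Proof. by move=> sQP Aa; rewrite /fiso autF_fus // autF_im ?eqxx. Qed.

Lemma fus_autF Q f : fus Q Q f -> exists2 a, a \in autF Q & {in Q, a =1 f}.
Proof.
move=> Ff; have [_ _ fM f_inj sfQ] := fus_hom Ff; have sQP := fus_sub Ff.
have aE := perm_inE f_inj sfQ; exists (perm_in f_inj sfQ) => //.
rewrite mem_autF // inE perm_in_on /=; apply/andP; split.
  by apply/morphicP=> x y Qx Qy; rewrite !aE ?groupM // fM.
by apply: fus_eq Ff => x Qx; rewrite aE.
Qed.

Lemma mem_autP Q a :
  reflect (exists2 y, y \in 'N_P(Q) & a = conj_aut Q y) (a \in autP Q).
Proof.
apply: (iffP morphimP) => [[y _ Ny ->]|[y Ny ->]]; exists y => //.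
by case/setIP: Ny.
Qed.

Lemma autP_sub Q : Q \subset P -> autP Q \subset autF Q.
Proof.
move=> sQP; apply/subsetP=> _ /mem_autP[y /setIP[Py nQy] ->].
rewrite mem_autF // (subsetP (Aut_conj_aut Q 'N(Q))) ?mem_morphim //=.
apply: (@fus_eq _ _ (fun z => z ^ y)) => [z Qz|]; first by rewrite norm_conj_autE.
by rewrite fus_conj // (normP nQy).
Qed.

Lemma pgroup_autP Q : p.-group (autP Q).
Proof. by rewrite morphim_pgroup // (pgroupS (subsetIl _ _)). Qed.

(** The Sylow axiom speaks of finite functions; [phi] identifies these with permutations and
    preserves cardinalities. *)
Lemma Sylow_autP_full : p.-Sylow(autF P) (autP P).
Proof.
pose phi (a : {perm gT}) := extid P a; have sPP := subxx P.
have phi_inj: {in Aut P &, injective phi}.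
  move=> a b Aa Ab /ffunP eq_ab; apply: (eq_Aut Aa Ab) => x Px.
  by have := eq_ab x; rewrite !extid_in.
have sAut: {subset autF P <= Aut P} by move=> a /(autF_Aut sPP).
have defF: AutF P F = phi @: autF P.
  apply/setP=> f; rewrite inE; apply/idP/imsetP => [Ff|[a]]; last first.
    by rewrite mem_autF // => /andP[_ Fa] ->.
  have [a Aa a_f] := fus_autF (fus_fcat Ff).
  by exists a; rewrite // -(extid_fcat Ff); apply/esym/extid_eq.
have defP: AutP P = phi @: autP P.
  have eq_conj x : x \in P -> conjmor x P = phi (conj_aut P x^-1).
    by move=> Px; apply: extid_eq => z Pz; rewrite conj_autE ?groupV.
  apply/setP=> f; apply/imsetP/imsetP=> [[x Px ->]|[_ /mem_autP[y /setIP[Py _] ->] ->]].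
    exists (conj_aut P x^-1); rewrite ?eq_conj //; apply/mem_autP.
    by exists x^-1; rewrite // inE groupV Px (subsetP (normG P)) ?groupV.
  by exists y^-1; rewrite ?groupV // eq_conj ?groupV // invgK.
have sPF := autP_sub sPP; have [_ _] := sat_syl satF; rewrite defF defP.
rewrite [#|phi @: autF P|]card_in_imset; last exact: sub_in2 sAut _ phi_inj.
rewrite [#|phi @: autP P|]card_in_imset; last first.
  by apply: sub_in2 phi_inj => a /(subsetP sPF)/sAut.
by rewrite divgS // => p'A; rewrite /pHall sPF p'A pgroup_autP.
Qed.

Lemma fus_norm (N R : {set gT}) Q g y :
  fus N R g -> Q \subset N -> y \in N -> y \in 'N(Q) -> g y \in 'N(g @: Q).
Proof.
move=> Fg sQN Ny nQy; rewrite inE; apply/subsetP=> _ /imsetP[_ /imsetP[z Qz ->] ->].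
have Nz := subsetP sQN z Qz.
by rewrite -(fusJ Fg) // imset_f // memJ_norm.
Qed.

Lemma autF_transport Q R f a : fiso Q R f -> a \in autF Q ->
  exists2 b, b \in autF R & {in Q, forall z, b (f z) = f (a z)}.
Proof.
move=> Ff Aa; have [g [Fg fK gK]] := fiso_inv Ff.
have sQP := fus_sub (fus_fiso Ff); have sRP := fus_sub (fus_fiso Fg).
have Fa := autF_fiso sQP Aa.
have [b Ab bE] := fus_autF (fus_fiso (fiso_comp (fiso_comp Fg Fa) Ff)).
exists b => // z Qz; rewrite bE /= ?fK //.
exact: fus_mem (fus_fiso Ff) Qz.
Qed.

(** [f] need only intertwine [a] and [b]; with [f] the identity this also compares powers of two
    permutations that agree on [Q]. *)
Lemma expgM_transport (Q : {set gT}) f (a b : {perm gT}) k :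
    (forall z, z \in Q -> a z \in Q) -> {in Q, forall z, b (f z) = f (a z)} ->
  {in Q, forall z, (b ^+ k) (f z) = f ((a ^+ k) z)}.
Proof.
move=> Qa ba z Qz.
suffices [] : (b ^+ k) (f z) = f ((a ^+ k) z) /\ (a ^+ k) z \in Q by [].
elim: k => [|k [IHk Qk]]; first by rewrite !perm1.
by rewrite !expgSr !permM IHk ba ?Qa.
Qed.

Lemma order_transport Q R f a b : fiso Q R f -> a \in autF Q -> b \in autF R ->
  {in Q, forall z, b (f z) = f (a z)} -> #[b] %| #[a].
Proof.
move=> Ff Aa Ab ba; have sQP := fus_sub (fus_fiso Ff).
have sRP: R \subset P by have [f' [/fus_fiso/fus_sub]] := fiso_inv Ff.
have Qa z : z \in Q -> a z \in Q by move=> Qz; rewrite Aut_closed ?(autF_Aut sQP).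
rewrite order_dvdn; apply/eqP; apply: (eq_Aut (A := R)).
- by rewrite (autF_Aut sRP) ?groupX.
- exact: group1.
move=> y; rewrite -(fiso_im Ff) => /imsetP[z Qz ->].
by rewrite (expgM_transport _ Qa ba) // expg_order !perm1.
Qed.

Lemma autF_Nphi Q a y : Q \subset P -> a \in autF Q -> y \in 'N_P(Q) ->
  conj_aut Q y ^ a \in autP Q -> y \in Nphi P Q (extid Q a).
Proof.
move=> sQP Aa Ny /mem_autP[u Nu cu]; have Fa := autF_fiso sQP Aa.
have [[_ nQy] [_ nQu]] := (setIP Ny, setIP Nu).
apply/NphiP; split=> //; rewrite (fiso_im Fa); exists u => // z Qz.
have Qaz := fus_mem (fus_fiso Fa) Qz.
by rewrite -(norm_conj_autE nQu) // -cu permJ norm_conj_autE.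
Qed.

(* If T > Aut_P(Q) is Sylow, a p-element phi of T normalising Aut_P(Q) extends to
   N_P(Q); a p-power-order power of the extension, transported to a fully
   normalised conjugate M of N_P(Q), is conjugate to an element of Aut_P(M), and
   maximality of |N_P(Q)| pulls the conjugating element back to N_P(Q). *)
Lemma Sylow_autP Q : Q \subset P -> fnorm Q -> p.-Sylow(autF Q) (autP Q).
Proof.
have [m] := ubnP (#|P| - #|Q|); elim: m Q => // m IHm Q leQm sQP fnQ.
have [/val_inj-> | ltQP] := eqVproper sQP; first exact: Sylow_autP_full.
have [T sylT sST] := Sylow_superset (autP_sub sQP) (pgroup_autP Q).
have [/val_inj-> // | ltST] := eqVproper sST.
have [sTA pT _] := and3P sylT.
have /properP[_ [phi /setIP[Tphi nSphi] S'phi]] := nilpotent_proper_norm (pgroup_nil pT) ltST.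
have Aphi := subsetP sTA _ Tphi; have Fphi := autF_fiso sQP Aphi.
(* As [phi] normalises Aut_P(Q), it extends to all of N_P(Q). *)
have defN: Nphi P Q (extid Q phi) = 'N_P(Q).
  apply/eqP; rewrite eqEsubset; apply/andP; split; apply/subsetP=> y; first by case/NphiP.
  by move=> Ny; apply: autF_Nphi; rewrite // memJ_norm //; apply/mem_autP; exists y.
have [N [g [eqN Fg gE]]] := fnorm_ext Fphi fnQ sQP; rewrite {}defN in eqN.
have sQN: Q \subset N by rewrite eqN subsetI sQP normG.
have gQ: g @: Q = Q by rewrite (eq_in_imset gE) (fiso_im Fphi).
have FNg: fus N N g.
  apply: (fus_cod Fg _ (fus_sub Fg)); apply/subsetP=> _ /imsetP[y Ny ->].
  have /setIP[_ nQy]: y \in 'N_P(Q) by rewrite -eqN.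
  have := fus_norm Fg sQN Ny nQy; rewrite gQ => nQgy.
  have: g y \in 'N_P(Q) by apply/setIP; split; first exact: fus_mem Fg Ny.
  by rewrite -eqN.
have sNP := fus_sub Fg.
have [a Aa aE] := fus_autF FNg.
(* Raising to the p'-part of the order of [a] makes [b] a p-element, while [phi ^+ k] still
   generates <[phi]> because [phi] is a p-element. *)
pose k := (#[a]`_p^')%N; pose b := a ^+ k.
have Ab: b \in autF N by rewrite groupX.
have [M [tau [Ft fnM]]] := fnorm_exists sNP.
have [b' Ab' b'E] := autF_transport Ft Ab.
have sMP: M \subset P by have [tau' [/fus_fiso/fus_sub]] := fiso_inv Ft.
have ltQN: #|Q| < #|N|.
  by rewrite eqN proper_card // nilpotent_proper_norm ?(pgroup_nil pP).
have cardM := fiso_card Ft.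
have sylM: p.-Sylow(autF M) (autP M).
  apply: IHm => //; rewrite cardM; rewrite ltnS in leQm; apply: leq_trans leQm.
  by rewrite ltn_sub2l // proper_card.
have Na z : z \in N -> a z \in N by move=> Nz; rewrite Aut_closed ?(autF_Aut sNP).
have Nb z : z \in N -> b z \in N by move=> Nz; rewrite Aut_closed ?(autF_Aut sNP).
have pb': p.-group <[b']>.
  have /pnat_dvd: #[b'] %| #[b] := order_transport Ft Ab Ab' b'E.
  apply; rewrite orderXdiv ?dvdn_part // -[X in X %/ _](partnC p) // mulnK //.
  exact: part_pnat.
have sb'A: <[b']> \subset autF M by rewrite cycle_subG.
have [c Ac] := Sylow_Jsub sylM sb'A pb'; rewrite -cycleJ cycle_subG.
case/mem_autP=> y Ny b'cE; pose sigma := c \o tau.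
have Fs: fiso N M sigma := fiso_comp Ft (autF_fiso sMP Ac).
have sigmaJ z : z \in N -> sigma z ^ y = sigma (b z).
  move=> Nz; have [_ nMy] := setIP Ny.
  rewrite -(norm_conj_autE nMy) ?(fus_mem (fus_fiso Fs)) // -b'cE /sigma /=.
  by rewrite permJ b'E.
have [Q2 [sQ FQ2]] := fus_img (fus_res (fus_fiso Fs) sQN).
have phib z : z \in Q -> (phi ^+ k) z = b z.
  move=> Qz; symmetry; apply: (@expgM_transport Q id phi a k) => // w Qw.
    exact: fus_mem (fus_fiso Fphi) Qw.
  by rewrite aE ?gE // (subsetP sQN).
have Qphik z : z \in Q -> (phi ^+ k) z \in Q.
  by apply: Aut_closed; rewrite groupX ?(autF_Aut sQP).
(* M normalises Q2 = sigma(Q), and |N_P(Q2)| <= |N_P(Q)| = |M| because [Q] is fully normalised. *)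
have NPQ2: M :=: 'N_P(Q2).
  apply/eqP; rewrite eqEcard; apply/andP; split.
    rewrite -[M : {set gT}](fiso_im Fs); apply/subsetP=> _ /imsetP[z Nz ->].
    rewrite inE (subsetP sMP) ?(fus_mem (fus_fiso Fs)) //= -sQ.
    by rewrite (fus_norm (fus_fiso Fs)) //; move: Nz; rewrite eqN => /setIP[].
  have [h [Fh _ _]] := fiso_inv FQ2.
  by rewrite cardM [X in _ <= #|pred_of_set X|]eqN (fnorm_leq fnQ Fh).
(* Through [sigma], conjugation by [y] is [b], which stabilises [Q]; hence [y] normalises Q2. *)
have My: y \in M.
  rewrite NPQ2; case/setIP: Ny => Py _; rewrite inE Py inE -sQ.
  apply/subsetP=> _ /imsetP[_ /imsetP[z Qz ->] ->].
  by rewrite sigmaJ ?(subsetP sQN) // -phib // imset_f // Qphik.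
have /imsetP[u Nu yE]: y \in sigma @: N by rewrite (fiso_im Fs).
have Su: u \in 'N_P(Q) by rewrite -eqN.
have Sphik: phi ^+ k \in autP Q.
  apply/mem_autP; exists u => //; apply: (eq_Aut (A := Q)).
  - by rewrite (autF_Aut sQP) ?groupX.
  - by rewrite (subsetP (Aut_conj_aut Q 'N(Q))) // mem_morphim //; case/setIP: Su.
  move=> z Qz; have Nz := subsetP sQN z Qz.
  rewrite norm_conj_autE //; last by case/setIP: Su.
  have [_ _ _ sigma_inj _] := fus_hom (fus_fiso Fs).
  apply: sigma_inj; rewrite ?groupJ ?phib ?Nb //.
  by rewrite (fusJ (fus_fiso Fs)) // -yE sigmaJ.
case/negP: S'phi; have: generator <[phi]> (phi ^+ k).
  rewrite generator_coprime; apply: pnat_coprime (mem_p_elt pT Tphi) _.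
  exact: part_pnat.
by rewrite -cycle_subG => /eqP->; rewrite cycle_subG.
Qed.

(** * Stability of [W] under morphisms *)

Variable n : nat.
Hypothesis clP : nil_class P <= n * (p - 1) + 1.
Local Notation W := 'Mho^n('Z(P)).

Lemma Mho_center_char : W \char P.
Proof. by rewrite gFchar_trans ?center_char. Qed.

Lemma Mho_center_sub Q : 'Z(P) \subset Q -> W \subset Q.
Proof. exact: subset_trans (Mho_sub _ _). Qed.

Lemma center_sub_centI Q : Q \subset P -> 'Z(P) \subset 'C_P(Q).
Proof. by move=> sQP; rewrite setIS ?centS. Qed.

Lemma imset_stable (Q R : {set gT}) f :
  fus Q R f -> W \subset Q -> f @: W \subset W -> f @: W = W.
Proof.
move=> /fus_hom[_ _ _ f_inj _] sWQ sfW; apply/eqP; rewrite eqEcard sfW card_in_imset //=.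
by move=> x y Wx Wy; apply: f_inj; apply: (subsetP sWQ).
Qed.

Lemma fus_full_stable f : fus P P f -> f @: W = W.
Proof.
move=> Ff; have [a Aa a_f] := fus_autF Ff.
have sWP := char_sub Mho_center_char.
apply: (imset_stable Ff) => //; rewrite -(eq_in_imset (sub_in1 (subsetP sWP) a_f)).
have [_ /forall_inP] := andP Mho_center_char; apply.
exact: autF_Aut (subxx P) Aa.
Qed.

(** Cauchy's theorem in the nontrivial p-group N_P(Q) / Q. *)
Lemma proper_normalizer_pgroup Q : Q \proper P ->
  exists x, [/\ x \in 'N_P(Q), x \notin Q & x ^+ p \in Q].
Proof.
move=> ltQP; have ltQN := nilpotent_proper_norm (pgroup_nil pP) ltQP.
have pN: p.-group ('N_P(Q) / Q) by rewrite quotient_pgroup ?(pgroupS (subsetIl _ _)).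
have ntN: 'N_P(Q) / Q != 1.
  by rewrite -subG1 quotient_sub1 ?subsetIr // proper_subn.
have [_ p_dv _] := pgroup_pdiv pN ntN.
have [_ /morphimP[x nQx Nx ->] ox] := Cauchy pr_p p_dv.
exists x; split=> //.
  by apply: contraL pr_p => Qx; rewrite -ox /= coset_id // order1.
by rewrite coset_idr ?groupX // morphX // -ox expg_order.
Qed.

(** The Frattini step. The hypothesis on larger domains [N] can omit Z(P) <= N, since C_P(Q) <= Q <
    N gives it. *)
Lemma autF_stable Q b :
    Q \proper P -> fnorm Q -> 'C_P(Q) \subset Q ->
    (forall N g, Q \proper N -> fus N P g -> g @: W = W) ->
  b \in autF Q -> b @: W = W.
Proof.
move=> ltQP fnQ cQ IH Ab; have sQP := proper_sub ltQP.
have sZQ: 'Z(P) \subset 'Z(Q).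
  rewrite subsetI (subset_trans (center_sub_centI sQP)) //.
  by rewrite (subset_trans (center_sub_centI sQP)) ?subsetIr.
pose M := 'Mho^n('Z(Q)); pose K := 'C_(autF Q)(M | 'P)%G.
have sWM: W \subset M by apply: MhoS.
have sMQ: M \subset Q := subset_trans (Mho_sub _ _) (center_sub Q).
have chM: M \char Q by rewrite gFchar_trans ?center_char.
have nKA: K <| autF Q.
  rewrite /normal subsetIl normsI ?normG //.
  apply: subset_trans (astab_norm _ _); apply/subsetP=> a Aa.
  have sMa: a @: M \subset M.
    have [_ /forall_inP] := andP chM; apply; exact: autF_Aut Aa.
  have defM: a @: M = M by apply/eqP; rewrite eqEcard sMa card_imset //=; apply: perm_inj.
  apply/astabsP=> z; rewrite /= /aperm -[in LHS]defM mem_imset //; exact: perm_inj.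
have sylX := Sylow_setI_normal nKA (Sylow_autP sQP fnQ).
have := Ab; rewrite -{1}(Frattini_arg nKA sylX).
case/mulsgP=> k t /setIP[_ /astabP fixk] /setIP[At nXt] ->.
have -> : (k * t)%g @: W = t @: W.
  by apply: eq_in_imset => w Ww; rewrite permM -[k w]/('P%act w k) fixk ?(subsetP sWM).
(* It remains to treat [t], which normalises K :&: Aut_P(Q). Conjugation by [x] lies in that group,
   so [t] sends it back into Aut_P(Q); thus [x] lies in the extension domain of [t]. *)
have [x [Nx Q'x Qxp]] := proper_normalizer_pgroup ltQP.
have [N [g [eqN Fg gE]]] := fnorm_ext (autF_fiso sQP At) fnQ sQP.
rewrite -(eq_in_imset (sub_in1 (subsetP (subset_trans sWM sMQ)) gE)).
apply: (IH _ _ _ Fg); apply/properP; split; first by rewrite eqN (sub_Nphi (autF_fiso sQP At)).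
exists x => //; rewrite eqN; apply: autF_Nphi => //.
suffices Xx: conj_aut Q x \in K :&: autP Q.
  by move: Xx; rewrite -(memJ_norm _ nXt) => /setIP[].
have Px: conj_aut Q x \in autP Q by apply/mem_autP; exists x.
rewrite inE Px andbT inE (subsetP (autP_sub sQP)) //=.
have [_ nQx] := setIP Nx.
have cMx: x \in 'C(M).
  apply: (@unipotent_cent_Mho _ p n P) => //.
  - exact: subset_trans (center_sub Q) sQP.
  - exact: center_abelian.
  - by case/setIP: Nx => Px' _; rewrite inE Px' (subsetP (char_norms (center_char Q))).
  by rewrite (subsetP _ _ Qxp) // centsC subsetIr.
apply/astabP=> z Mz; rewrite /= /aperm norm_conj_autE ?(subsetP sMQ) //.
by rewrite /conjg -(centP cMx) ?mulKg.
Qed.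

Lemma fnorm_ext_center (R R' : {group gT}) f : fiso R R' f -> fnorm R' -> R \subset P ->
  exists N g, [/\ N = Nphi P R (extid R f) :> {set gT}, R \subset N, 'C_P(R) \subset N,
                  'Z(P) \subset N & fus N P g /\ {in R, g =1 f}].
Proof.
move=> Ff fnR' sRP; have [N [g [eqN Fg gE]]] := fnorm_ext Ff fnR' sRP.
have sCN: 'C_P(R) \subset N by rewrite eqN (cent_sub_Nphi Ff).
exists N, g; split=> //; first by rewrite eqN (sub_Nphi Ff).
exact: subset_trans (center_sub_centI sRP) sCN.
Qed.

(** [R] need not contain Z(P), but the extension domain does, so that stability of [W] makes sense
    for [g]. *)
Definition extends_stably R := forall R' f, fiso R R' f -> fnorm R' ->
  exists N g, [/\ 'Z(P) \subset N, R \subset N, fus N P g, {in R, g =1 f} & g @: W = W].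

(** With [tau] from the image of [f] to a fully normalised subgroup, both [tau \o f] and [tau]
    extend stably; injectivity of the extension of [tau] then puts f(W) inside [W]. *)
Lemma stable_of_extends m :
    (forall R, R \subset P -> #|R| = m -> extends_stably R) ->
  forall Q f, #|Q| = m -> 'Z(P) \subset Q -> fus Q P f -> f @: W = W.
Proof.
move=> extm Q f cardQ sZQ Ff; have sQP := fus_sub Ff.
have sWQ := Mho_center_sub sZQ.
have [R [fQ FfR]] := fus_img Ff; have sRP: R \subset P by rewrite -fQ; case/fus_hom: Ff.
have [S [tau [Ft fnS]]] := fnorm_exists sRP.
have [N [g [_ _ _ gE gW]]] := extm Q sQP cardQ S _ (fiso_comp FfR Ft) fnS.
have cardR: #|R| = m by rewrite (fiso_card FfR).
have [N2 [g2 [sZN2 sRN2 Fg2 g2E g2W]]] := extm R sRP cardR S _ Ft fnS.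
apply: (imset_stable Ff) => //; apply/subsetP=> _ /imsetP[w Ww ->].
have Rfw: f w \in R by rewrite -fQ imset_f // (subsetP sWQ).
have: g2 (f w) \in W.
  by rewrite g2E // -[tau _]/((tau \o f) w) -gE ?(subsetP sWQ) // -gW imset_f.
rewrite -{1}g2W => /imsetP[w' Ww' eq_g2].
have [_ _ _ g2_inj _] := fus_hom Fg2.
have N2w' := subsetP (Mho_center_sub sZN2) _ Ww'.
by rewrite (g2_inj _ _ (subsetP sRN2 _ Rfw) N2w' eq_g2).
Qed.

Lemma all_extends_stably R : R \subset P -> extends_stably R.
Proof.
have [m] := ubnP (#|P| - #|R|); elim: m R => // m IHm R leRm sRP R' f Ff fnR'.
(* Stated for every [Q] of the order of [R], so that it serves R' as well. *)
have IH Q N g : #|Q| = #|R| -> Q \proper N -> 'Z(P) \subset N -> fus N P g -> g @: W = W.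
  move=> cardQ ltQN sZN Fg; apply: (stable_of_extends _ (erefl #|N|) sZN Fg) => S sSP cardS.
  apply: IHm sSP; rewrite ltnS in leRm; apply: leq_trans leRm.
  rewrite cardS -cardQ ltn_sub2l ?proper_card //.
  exact: proper_sub_trans ltQN (fus_sub Fg).
have sR'P: R' \subset P by have [f' [/fus_fiso/fus_sub]] := fiso_inv Ff.
have cardR' := fiso_card Ff.
have [N [g [eqN sRN sCN sZN [Fg gE]]]] := fnorm_ext_center Ff fnR' sRP.
exists N, g; split=> //.
(* A strictly larger domain is covered by induction. Otherwise R = N contains C_P(R), and it must be
   shown that [f] itself fixes [W]. *)
have [eqRN | ltRN] := eqVproper sRN; last exact: IH ltRN sZN Fg.
rewrite -eqRN in sCN sZN; have sWR := Mho_center_sub sZN.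
have gfW : g @: W = f @: W := eq_in_imset (sub_in1 (subsetP sWR) gE).
have [eqRP | ltRP] := eqVproper sRP.
  by apply: fus_full_stable; rewrite -{1}eqRP eqRN.
have ltR'P: R' \proper P by rewrite properEcard sR'P cardR' proper_card.
have autW b : b \in autF R' -> W \subset R' -> b @: W = W.
  move=> Ab sWR'; have Fb := autF_fiso sR'P Ab.
  (* If C_P(R') is not inside R', then [b] extends over it to a strictly larger subgroup, where
     induction applies. *)
  have [cR' | ncR'] := boolP ('C_P(R') \subset R').
    apply: (autF_stable ltR'P fnR' cR') => // N1 g1 ltN1; apply: (IH R' N1 g1 cardR' ltN1).
    exact: subset_trans (subset_trans (center_sub_centI sR'P) cR') (proper_sub ltN1).
  have [N1 [g1 [_ sN1 sCN1 sZN1 [Fg1 g1E]]]] := fnorm_ext_center Fb fnR' sR'P.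
  rewrite -(eq_in_imset (sub_in1 (subsetP sWR') g1E)); apply: IH cardR' _ sZN1 Fg1.
  by rewrite properE sN1; apply: contra ncR'; apply: subset_trans.
(* X is the transport of Aut_P(R) to R' along f *)
pose x_rel (a : {perm gT}) y := [forall z in R, a (f z) == f (z ^ y)].
pose X := [set a in autF R' | [exists y in 'N_P(R), x_rel a y]].
have inX a :
  reflect (a \in autF R' /\
           exists2 y, y \in 'N_P(R) & {in R, forall z, a (f z) = f (z ^ y)})
          (a \in X).
  rewrite [X in reflect _ X]in_set; apply: (iffP andP) => -[Aa].
    case/exists_inP=> y Ny /forall_inP ay; split=> //.
    by exists y => // z Rz; apply/eqP/ay.
  case=> y Ny ay; split=> //; apply/exists_inP; exists y => //.
  by apply/forall_inP=> z Rz; apply/eqP/ay.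
have gX: group_set X.
  apply/group_setP; split=> [|a b /inX[Aa [y Ny ay]] /inX[Ab [u Nu bu]]]; apply/inX.
    by split=> //; exists 1 => // z _; rewrite perm1 conjg1.
  split; first exact: groupM.
  exists (y * u) => [|z Rz]; first exact: groupM.
  by rewrite permM ay // bu ?conjgM // memJ_norm //; case/setIP: Ny.
have sXA: Group gX \subset autF R' by apply/subsetP=> a /inX[].
have autXy y a : y \in 'N_P(R) -> {in R, forall z, a (f z) = f (z ^ y)} ->
    {in R, forall z, a (f z) = f (conj_aut R y z)}.
  by case/setIP=> _ nRy ay z Rz; rewrite norm_conj_autE // ay.
have Ay y : y \in 'N_P(R) -> conj_aut R y \in autP R by move=> Ny; apply/mem_autP; exists y.
have pX: p.-group (Group gX).
  apply/pgroupP=> q pr_q /(Cauchy pr_q)[a /inX[Aa [y Ny ay]] oa].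
  have := order_transport Ff (subsetP (autP_sub sRP) _ (Ay y Ny)) Aa (autXy y a Ny ay).
  move/pnat_dvd/(_ (mem_p_elt (pgroup_autP R) (Ay y Ny))).
  by rewrite oa pnatE.
(* Sylow's theorem moves [X] into Aut_P(R') by some [c]; then [c \o f] extends to N_P(R) > R, so it
   fixes [W] by induction. Since [c] fixes [W] by [autW], so does [f]. *)
have [c Ac sXc] := Sylow_Jsub (Sylow_autP sR'P fnR') sXA pX.
have Fc := autF_fiso sR'P Ac; have Fcf := fiso_comp Ff Fc.
have sN1: 'N_P(R) \subset Nphi P R (extid R (c \o f)).
  apply/subsetP=> y Ny; apply/NphiP; split=> //; rewrite (fiso_im Fcf).
  have [a Aa ay] := autF_transport Ff (subsetP (autP_sub sRP) _ (Ay y Ny)).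
  have /(subsetP sXc)/mem_autP[u Nu acu]: a ^ c \in X :^ c.
    rewrite memJ_conjg; apply/inX; split=> //; exists y => // z Rz.
    by rewrite ay // norm_conj_autE //; case/setIP: Ny.
  exists u => // z Rz; have R'z := fus_mem (fus_fiso Fcf) Rz.
  have [_ nRy] := setIP Ny; have [_ nR'u] := setIP Nu.
  by rewrite -(norm_conj_autE nR'u) // -acu /= permJ ay // norm_conj_autE.
have [N1 [g1 [eqN1 sRN1 _ sZN1 [Fg1 g1E]]]] := fnorm_ext_center Fcf fnR' sRP.
have cfW: c @: (f @: W) = W.
  rewrite -imset_comp -(eq_in_imset (sub_in1 (subsetP sWR) g1E)).
  apply: (IH R _ _ (erefl _) _ sZN1 Fg1).
  apply: proper_sub_trans (nilpotent_proper_norm (pgroup_nil pP) ltRP) _.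
  by rewrite eqN1.
have sWR': W \subset R'.
  rewrite -cfW -(fiso_im Fc) imsetS // -(fiso_im Ff) imsetS //.
rewrite gfW -[RHS](autW c^-1) ?groupV // -{2}cfW -[in RHS]imset_comp.
by rewrite -[LHS]imset_id; apply: eq_imset => z /=; rewrite permK.
Qed.

(** * From stability of [W] to its normality in F *)

Lemma imset_fusM (N R A B : {set gT}) f : fus N R f -> A \subset N -> B \subset N ->
  f @: (A * B) = f @: A * f @: B.
Proof.
case/fus_hom=> _ _ fM _ _ /subsetP sAN /subsetP sBN.
apply/eqP; rewrite eqEsubset; apply/andP; split; apply/subsetP=> y.
  case/imsetP=> _ /mulsgP[a b Aa Bb ->] ->; rewrite (fM _ _ (sAN a Aa) (sBN b Bb)).
  by apply: mem_mulg; apply: imset_f.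
case/mulsgP=> _ _ /imsetP[a Aa ->] /imsetP[b Bb ->] ->.
by rewrite -(fM _ _ (sAN a Aa) (sBN b Bb)); apply/imset_f/mem_mulg.
Qed.

(** With [tau] from the image S of the morphism to a fully normalised T, extend [tau \o f0] by [g1]
    and [tau] by [g2]. Both map onto W * T, from W * Q and W * S, so the inverse of [g2] after [g1]
    extends [f0] and fixes [W]. *)
Lemma normalF_Mho_center : normalF P F W.
Proof.
have chW := Mho_center_char; have nWP := char_norm chW.
split=> [||Q0 R0 f0 Ff0]; [exact: char_sub | by [] | ].
have [/andP[gQ sQP] /andP[gR sRP] _ _ sfR] := fus_hom (fus_fcat Ff0).
pose Q := Group gQ; pose R := Group gR.
have [S [fQ FfS]] := fus_img (fus_fcat Ff0 : fus Q R f0).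
have sSP: S \subset P by rewrite -fQ (subset_trans sfR).
have [T [tau [Ft fnT]]] := fnorm_exists sSP.
have FfT := fiso_comp FfS Ft.
have [N1 [g1 [sZN1 sQN1 Fg1 g1E g1W]]] :=
  all_extends_stably (sQP : Q \subset P) FfT fnT.
have [N2 [g2 [sZN2 sSN2 Fg2 g2E g2W]]] := all_extends_stably sSP Ft fnT.
have WN1 := Mho_center_sub sZN1; have WN2 := Mho_center_sub sZN2.
have gWM (D : {group gT}) : D \subset P -> W * D = W <*> D.
  by move=> sDP; rewrite norm_joinEr // (subset_trans sDP).
have g1WQ: g1 @: (W <*> Q) = W * T.
  rewrite -gWM // (imset_fusM Fg1) // g1W (eq_in_imset g1E).
  by rewrite (fiso_im (fiso_comp FfS Ft)).
have g2WS: g2 @: (W <*> S) = W * T.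
  by rewrite -gWM // (imset_fusM Fg2) // g2W (eq_in_imset g2E) (fiso_im Ft).
have sWQ1: W <*> Q \subset N1 by rewrite join_subG WN1.
have sWS2: W <*> S \subset N2 by rewrite join_subG WN2.
have [U [eqU F1]] := fus_img (fus_res Fg1 sWQ1).
have F2: fiso (W <*> S) U g2.
  by have [U2 [<-]] := fus_img (fus_res Fg2 sWS2); rewrite -eqU g1WQ g2WS.
have [h [Fh g2K _]] := fiso_inv F2.
have hgW: (h \o g1) @: W = W.
  rewrite imset_comp g1W -{1}g2W -imset_comp -[RHS]imset_id.
  by apply: eq_in_imset => w Ww /=; rewrite g2K // (subsetP (joing_subl _ _)).
have Fhg: fus (W <*> Q) (W <*> R) (h \o g1).
  have Fhg := fiso_comp F1 Fh; have sWP: W \subset P by apply: char_sub.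
  apply: (fus_cod (fus_fiso Fhg)); last by rewrite join_subG sWP.
  by rewrite (fiso_im Fhg) genS // setUS // -fQ.
exists (extid (W <*> Q) (h \o g1)); rewrite (gWM Q sQP) (gWM R sRP); split=> //.
  move=> z Qz; rewrite extid_in ?(subsetP (joing_subr _ _)) //= g1E //=.
  have Sfz: f0 z \in S by rewrite -fQ imset_f.
  by rewrite -(g2E _ Sfz) g2K // (subsetP (joing_subr _ _)).
rewrite -[RHS]hgW; apply: eq_in_imset => w Ww.
by rewrite extid_in // (subsetP (joing_subl _ _)).
Qed.

End FusionSystem.

Theorem theorem1p3 (gT : finGroupType) (p n : nat) (P : {group gT}) (F : fcat gT) :
  prime p -> p.-group P -> P :!=: 1 ->
  nil_class P <= n * (p - 1) + 1 ->
  saturated p P F ->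
  normalF P F (mho p n 'Z(P)).
Proof.
move=> pr_p pP _ clP satF.
(* ['Mho^n] reads the prime off each element's order; in a p-group this gives the p^n-th powers. *)
have -> : mho p n 'Z(P) = 'Mho^n('Z(P)) by rewrite (MhoE n (pgroupS (center_sub P) pP)).
exact: (normalF_Mho_center pr_p pP satF clP).
Qed.
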